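(* Let $f(x)\in\mathbb{Z}[x]$ be such that $f(x)+x$ is nonconstant and $0$ is periodic under $x\mapsto f(x)$ with exact period length $2$. Write $f^2(x)=x^rG(x)$ with $G(x)\in\mathbb{Z}[x]$, $G(0)\neq0$ and $r\ge1$. Let $x_0\in\mathbb{Z}$ have a wandering orbit $(x_n)_{n\ge0}$ under $f$, and define \[ a_{n+2}=\frac{G(x_n)}{\gcd(G(x_n),G(0)f(0))}\quad\text{for all } n\ge0. \] Then $(a_n)_{n\ge2}$ is an infinite sequence of pairwise coprime integers, and for all sufficiently large $n$, $a_n$ has a private prime factor.
   Context: $f^n$ denotes the $n$-fold composition of $f$; the orbit of $x_0$ is $x_n=f^n(x_0)$. $0$ is periodic with exact period length $2$ means $f(0)\neq0$ and $f^2(0)=0$. The orbit is wandering if the $x_n$, $n\ge0$, are pairwise distinct. For a sequence of integers $(a_n)$, a prime $p$ is a private prime factor of $a_n$ if $p$ divides $a_n$ and no other term $a_m$, $m\ne n$. *)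

(* Defs.v *)
From mathcomp Require Import all_boot all_order all_algebra.

Set Implicit Arguments.
Unset Strict Implicit.
Unset Printing Implicit Defensive.

Import Order.TTheory GRing.Theory Num.Theory.
Local Open Scope ring_scope.

Definition orbit_pt (f : {poly int}) (x0 : int) (n : nat) : int :=
  iter n (fun x => f.[x]) x0.

Definition wandering (f : {poly int}) (x0 : int) : Prop :=
  injective (orbit_pt f x0).

Definition zero_exact_period2 (f : {poly int}) : Prop :=
  f.[0] <> 0 /\ f.[f.[0]] = 0.

(* In the next two definitions the sequence is (a_n)_{n >= s}: the values of a
   below s are not terms and play no role. *)
Definition pairwise_coprime_from (s : nat) (a : nat -> int) : Prop :=
  forall m n : nat, (s <= m)%N -> (s <= n)%N -> m <> n ->
    coprimez (a m) (a n).

Definition private_prime_factor (s : nat) (a : nat -> int) (n p : nat) : Prop :=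
  [/\ prime p, (p%:Z %| a n)%Z &
      forall m : nat, (s <= m)%N -> m <> n -> ~ (p%:Z %| a m)%Z].

(* Main.v *)
(** Let c = f(0), D = G(0)c and suppose an integer q divides G(x_m) and G(x_n)
    with m < n. Then q divides x_(m+2), so modulo q the orbit continues 0, c, 0,
    c, ... from the index m+2 on; since G(c) = 1 or -1 (because
    c = f^2(c) = c^r G(c)), every position of n forces q to divide D. A prime
    dividing both a_(m+2) and a_(n+2) has such a power q not dividing D.
    For the private prime factors it then suffices that |G(x_n)| > |D|
    eventually, i.e. that G is nonconstant. If f^2 = b x^r, the chain rule along
    the 2-cycle {0, c} gives f^2 the same derivative at 0 and at c, so r = 1; then
    f is affine and exchanges 0 and c, i.e. f(x) = c - x. *)
From Stdlib Require Import Classical.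
Require Import Defs.
From mathcomp Require Import all_boot all_order all_algebra.
From mathcomp Require Import zify ring.

Set Implicit Arguments.
Unset Strict Implicit.
Unset Printing Implicit Defensive.

Import Order.TTheory GRing.Theory Num.Theory.
Local Open Scope ring_scope.

Lemma dvdz_horner_sub (p : {poly int}) (q x y : int) :
  (q %| x - y)%Z -> (q %| p.[x] - p.[y])%Z.
Proof.
move=> qxy; elim/poly_ind: p => [|p c IHp]; first by rewrite !horner0 subrr dvdz0.
have -> : (p * 'X + c%:P).[x] - (p * 'X + c%:P).[y]
    = (p.[x] - p.[y]) * x + p.[y] * (x - y) by rewrite !hornerE; ring.
by apply: rpredD; [apply: dvdz_mulr | apply: dvdz_mull].
Qed.

(** At [p] the quotient has valuation v(m) - min(v(m), v(d)), which is positive only if v(m) > v(d).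
    The exponent is the least one whose power of [p] does not divide [d]. *)
Lemma prime_pow_dvd_of_dvd_div_gcd (p m d : nat) :
  prime p -> (0 < m)%N -> (0 < d)%N -> (p %| m %/ gcdn m d)%N ->
  (p ^ (logn p d).+1 %| m)%N.
Proof.
move=> p_pr m_gt0 d_gt0 p_dvd.
have q_gt0 : (0 < m %/ gcdn m d)%N.
  by rewrite divn_gt0 ?gcdn_gt0 ?m_gt0 // dvdn_leq ?dvdn_gcdl.
have : (0 < logn p (m %/ gcdn m d))%N by rewrite logn_gt0 mem_primes p_pr q_gt0.
rewrite logn_div ?dvdn_gcdl // logn_gcd // pfactor_dvdn //; lia.
Qed.

(** Induction on the size: a root met by the sequence is divided out, and injectivity keeps [u] from
    returning to it. *)
Lemma injective_eventually_nonroot (u : nat -> int) (p : {poly int}) :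
  injective u -> p != 0 ->
  exists N, forall n, (N <= n)%N -> p.[u n] != 0.
Proof.
move=> u_inj; have [k] := ubnP (size p); elim: k p => // k IHk p szp p_neq0.
have [[n pn0] | no_root] := classic (exists n, p.[u n] = 0); last first.
  by exists 0%N => n _; apply/eqP => pn0; apply: no_root; exists n.
have [q pE] : exists q, p = q * ('X - (u n)%:P) by apply/factor_theorem/eqP.
have q_neq0 : q != 0 by apply: contraNneq p_neq0 => q0; rewrite pE q0 mul0r.
have [|N HN] := IHk q _ q_neq0.
  by move: szp; rewrite pE size_mul ?polyXsubC_eq0 // size_XsubC addn2 ltnS.
exists (maxn N n.+1) => m; rewrite geq_max => /andP[leNm ltnm].
rewrite pE !hornerE mulf_neq0 ?HN // subr_eq0.
by apply/eqP => /u_inj mn; rewrite mn ltnn in ltnm.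
Qed.

Lemma injective_eventually_large (u : nat -> int) (p : {poly int}) (B : nat) :
  injective u -> (1 < size p)%N ->
  exists N, forall n, (N <= n)%N -> (B < `|p.[u n]|)%N.
Proof.
move=> u_inj szp; elim: B => [|B [N HN]].
  have [|N HN] := injective_eventually_nonroot (p := p) u_inj.
    by rewrite -size_poly_gt0; lia.
  by exists N => n /HN; rewrite absz_gt0.
(* Raising the bound by one only requires avoiding the two values [B.+1] and [- B.+1], each attained
   finitely often. *)
have pB_neq0 (b : int) : p - b%:P != 0.
  rewrite subr_eq0; apply: contraTneq szp => ->.
  by rewrite size_polyC; case: (b != 0).
have [N1 HN1] := injective_eventually_nonroot u_inj (pB_neq0 B.+1%:Z).
have [N2 HN2] := injective_eventually_nonroot u_inj (pB_neq0 (- B.+1%:Z)).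
exists (maxn N (maxn N1 N2)) => n; rewrite !geq_max => /and3P[/HN ltB].
by move=> /HN1 + /HN2; rewrite !hornerE; lia.
Qed.

Section TwoCycle.

Variables (f G : {poly int}) (r : nat).
Hypotheses (period2 : zero_exact_period2 f) (f2E : f \Po f = 'X^r * G).

Lemma unit_cofactor_at_f0 : (0 < r)%N -> (`|G.[f.[0]]| = 1)%N.
Proof.
case: period2 => /eqP c_neq0 fc0 r_gt0.
have : (f \Po f).[f.[0]] = f.[0] by rewrite horner_comp fc0.
rewrite f2E !hornerE -(prednK r_gt0) exprS -mulrA -[RHS]mulr1.
move/(mulfI c_neq0)/(congr1 absz); rewrite abszM => /eqP.
by rewrite muln_eq1 => /andP[_ /eqP].
Qed.

Lemma cofactor_nonconstant :
  G.[0] != 0 -> (1 < size (f + 'X)%R)%N -> (1 < size G)%N.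
Proof.
case: period2 => /eqP c_neq0 fc0 G0_neq0; apply: contraLR.
rewrite -!leqNgt => /size1_polyC GE.
set b := G`_0 in GE.
have b_neq0 : b != 0 by move: G0_neq0; rewrite GE hornerC.
have derE x : (f \Po f)^`().[x] = f^`().[f.[x]] * f^`().[x].
  by rewrite deriv_comp !hornerE horner_comp.
(* With c = [f.[0]], both derivatives are f'(0) f'(c). Cancelling [b] leaves r 0^(r-1) = r c^(r-1),
   impossible for r >= 2. *)
have := derE 0; have := derE f.[0]; rewrite fc0 [RHS]mulrC => <-.
rewrite f2E GE mulrC mul_polyC derivZ derivXn !hornerE !hornerMn !hornerXn.
move=> /(mulfI b_neq0) der_eq.
have r_le1 : (r <= 1)%N.
  case: r der_eq => [|[|k]] //= /eqP.
  by rewrite exprS mul0r mul0rn eq_sym mulrn_eq0 expf_eq0 (negPf c_neq0) andbF.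
(* Comparing degrees in [f2E] gives (deg f)^2 = r. *)
have szf : (size f <= 2)%N.
  have := size_comp_poly f f; rewrite f2E GE mulrC mul_polyC size_scale // size_polyXn.
  by move=> /= rE; move: r_le1; rewrite rE; case: (size f) => [|[|[|s]]] //; nia.
have fE : f = f`_1 *: 'X + f.[0]%:P.
  apply/polyP => i; rewrite horner_coef0 coefD coefZ coefX coefC.
  case: i => [|[|i]] /=; rewrite ?mulr0 ?mulr1 ?add0r ?addr0 //.
  by rewrite nth_default //; apply: leq_trans szf _.
have f1E : f`_1 = -1.
  move: fc0; rewrite {1}fE !hornerE -{2}[f.[0]]mul1r -mulrDl => /eqP.
  by rewrite mulf_eq0 (negPf c_neq0) orbF addr_eq0 => /eqP.
by rewrite fE f1E scaleN1r addrAC addNr add0r size_polyC; case: (_ != 0).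
Qed.

Variable x0 : int.
Notation x := (orbit_pt f x0).

Lemma orbitS n : x n.+1 = f.[x n]. Proof. by []. Qed.

Lemma orbitSS n : x n.+2 = x n ^+ r * G.[x n].
Proof. by rewrite !orbitS -horner_comp f2E !hornerE. Qed.

Lemma dvdz_orbit_sub (q : int) m j :
  (q %| x m)%Z -> (q %| x (j + m) - (if odd j then f.[0] else 0))%Z.
Proof.
move=> q_xm; elim: j => [|j IHj]; first by rewrite subr0.
have := dvdz_horner_sub f IHj; rewrite addSn orbitS /=.
by case: (odd j) => //=; case: period2 => _ ->.
Qed.

Lemma dvdz_common_cofactor (q : int) m n :
  (0 < r)%N -> (m < n)%N -> (q %| G.[x m])%Z -> (q %| G.[x n])%Z ->
  (q %| G.[0] * f.[0])%Z.
Proof.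
move=> r_gt0 ltmn qGm qGn.
have q_SS k : (q %| G.[x k])%Z -> (q %| x k.+2)%Z.
  by move=> qGk; rewrite orbitSS dvdz_mull.
have dvdz_subE (y z : int) : (q %| y)%Z -> (q %| y - z)%Z -> (q %| z)%Z.
  by move=> qy; rewrite rpredBl.
(* If n = m+1, then x_(n+2) = x_(m+3) is congruent to both 0 and f(0) modulo [q], so [q] divides
   f(0). *)
move: (ltmn); rewrite leq_eqVlt => /predU1P[nE | ltm1n].
  apply: dvdz_mull; apply: (dvdz_subE (x n.+2)); first exact: q_SS.
  by rewrite -nE; apply: (dvdz_orbit_sub 1 (q_SS m qGm)).
(* Otherwise x_n is itself congruent to 0 or f(0), so [q] divides G(0) or the unit G(f(0)). *)
have := dvdz_horner_sub G (dvdz_orbit_sub (n - m.+2) (q_SS m qGm)).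
rewrite subnK // => /(dvdz_subE _ _ qGn); case: ifP => _ qG.
  by move: qG; rewrite dvdzE unit_cofactor_at_f0 // dvdn1 => /eqP q1; rewrite dvdzE q1.
exact: dvdz_mulr.
Qed.

(** A zero of [G] on the orbit would give x_(n+2) = 0, hence also x_(n+4) = 0, a repetition. *)
Lemma cofactor_orbit_neq0 n : (0 < r)%N -> wandering f x0 -> G.[x n] != 0.
Proof.
move=> r_gt0 x_inj; apply/eqP => Gn0.
have x2 : x n.+2 = 0 by rewrite orbitSS Gn0 mulr0.
have x4 : x n.+4 = 0 by rewrite orbitSS x2 expr0n gtn_eqF // mul0r.
by have /x_inj/eqP := etrans x4 (esym x2); rewrite !eqSS -[X in _ == X]add0n (eqn_add2r n 2 0).
Qed.

End TwoCycle.

Theorem theorem6 (f G : {poly int}) (r : nat) (x0 : int) (a : nat -> int)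
  (f_addX_nonconstant : (1 < size (f + 'X)%R)%N)
  (period2 : zero_exact_period2 f)
  (r_ge1 : (1 <= r)%N)
  (f2E : f \Po f = 'X^r * G)
  (G0_neq0 : G.[0] <> 0)
  (x0_wandering : wandering f x0)
  (aE : forall n : nat,
     a n.+2 = (G.[orbit_pt f x0 n]
                 %/ gcdz G.[orbit_pt f x0 n] (G.[0] * f.[0]))%Z) :
  pairwise_coprime_from 2 a /\
  exists N : nat, forall n : nat, (2 <= n)%N -> (N <= n)%N ->
    exists p : nat, private_prime_factor 2 a n p.
Proof.
have /eqP G0 := G0_neq0; have [/eqP c_neq0 _] := period2.
set D := G.[0] * f.[0] in aE.
have D_gt0 : (0 < `|D|)%N by rewrite absz_gt0 mulf_neq0.
pose g n := G.[orbit_pt f x0 n].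
have g_gt0 n : (0 < `|g n|)%N.
  by rewrite absz_gt0 (cofactor_orbit_neq0 f2E).
have absaE n : (`|a n.+2| = `|g n| %/ gcdn `|g n| `|D|)%N.
  have gE : (`|g n| = `|a n.+2| * gcdn `|g n| `|D|)%N.
    by rewrite aE -[in LHS](divzK (dvdz_gcdl (g n) D)) abszM.
  by rewrite [X in (X %/ _)%N]gE mulnK // gcdn_gt0 g_gt0.
have a_gt0 n : (0 < `|a n.+2|)%N.
  by rewrite absaE divn_gt0 ?gcdn_gt0 ?g_gt0 // dvdn_leq ?dvdn_gcdl.
have no_common p m n : (m < n)%N -> prime p ->
    (p %| `|a m.+2|)%N -> (p %| `|a n.+2|)%N -> False.
  move=> ltmn p_pr; rewrite !absaE.
  move=> /(prime_pow_dvd_of_dvd_div_gcd p_pr (g_gt0 m) D_gt0) pm.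
  move=> /(prime_pow_dvd_of_dvd_div_gcd p_pr (g_gt0 n) D_gt0) pn.
  have := dvdz_common_cofactor period2 f2E
    (q := (p ^ (logn p `|D|).+1)%N%:Z) r_ge1 ltmn pm pn.
  by rewrite dvdzE absz_nat pfactor_dvdn // ltnn.
have no_common_neq p m n : (2 <= m)%N -> (2 <= n)%N -> m <> n -> prime p ->
    (p %| `|a m|)%N -> (p %| `|a n|)%N -> False.
  case: m n => [|[|m]] [|[|n]] // _ _ neq_mn p_pr pm pn.
  have [ltmn|ltnm|eqmn] := ltngtP m n; last by apply: neq_mn; rewrite eqmn.
    exact: (no_common p m n).
  exact: (no_common p n m).
split=> [m n m_ge2 n_ge2 neq_mn|].
  rewrite coprimezE /coprime; apply/negPn/negP => gcd_neq1.
  (* A gcd different from 1 could still be 0; nonvanishing of the terms excludes this. *)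
  have gcd_gt1 : (1 < gcdn `|a m| `|a n|)%N.
    rewrite ltn_neqAle eq_sym gcd_neq1 gcdn_gt0.
    by case: m m_ge2 {neq_mn gcd_neq1} => [|[|m]] // _; rewrite a_gt0.
  have /andP[pm pn] : (pdiv (gcdn `|a m| `|a n|) %| `|a m|)%N
      && (pdiv (gcdn `|a m| `|a n|) %| `|a n|)%N.
    by rewrite -dvdn_gcd pdiv_dvd.
  exact: (no_common_neq _ m n _ _ _ (pdiv_prime gcd_gt1)).
have szG := cofactor_nonconstant period2 f2E G0 f_addX_nonconstant.
have [N HN] := injective_eventually_large `|D| x0_wandering szG.
exists N.+2 => -[|[|n]] // n_ge2 /HN ltD.
(* If the quotient were 1 in absolute value, |G(x_n)| would equal its gcd with [D] and could not
   exceed |D|. *)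
have a_gt1 : (1 < `|a n.+2|)%N.
  rewrite ltn_neqAle a_gt0 andbT eq_sym; apply: contraTneq ltD => an1.
  rewrite -leqNgt -/(g n) -[`|g n|%N](divnK (dvdn_gcdl _ `|D|)) -absaE an1 mul1n.
  by rewrite dvdn_leq // dvdn_gcdr.
exists (pdiv `|a n.+2|); split; first exact: pdiv_prime.
  by rewrite dvdzE pdiv_dvd.
move=> m m_ge2 neq_mn; rewrite dvdzE => pm.
exact: (no_common_neq _ m n.+2 _ _ _ (pdiv_prime a_gt1) pm (pdiv_dvd _)).
Qed.
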